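(* Let $d\ge 4$ be an even integer and suppose that $d=r+s$ with $r=s$. Suppose that $\alpha\neq\beta$ in $\mathbb{T}$ satisfy Condition (P) (with respect to $r,s$). Let $V:=\alpha I_r\oplus\beta I_r\in\mathcal{U}(\mathbb{C}^d)$. Then $V\in\mathrm{Sym}_3(\mathbb{C}^d)$ if and only if one of the following three conditions holds: (i) $d$ is divisible by $4$, $(\alpha\beta)^r=-1$, and $|e^{i\frac{r-1}{r}\pi}-1|<|\alpha-\beta|$; (ii) $d$ is not divisible by $4$, and $|e^{i\frac{r-1}{r}\pi}-1|<|\alpha-\beta|$; (iii) $d$ is not divisible by $4$, $(\alpha\beta)^r=-1$, and $|1-\alpha^{2j+1}\beta^{2j-1}|<|\alpha-\beta|$ for all $1\le j\le r-1$.
   Context: $\mathbb{T}=\{z\in\mathbb{C}:|z|=1\}$; $\mathcal{U}(\mathbb{C}^d)$ is the group of unitary $d\times d$ matrices. A symmetry on $\mathbb{C}^d$ is an operator $J$ with $J=J^*=J^{-1}$. $\mathrm{Sym}_k(\mathbb{C}^d)$ is the set of all products $J_1J_2\cdots J_k$ of $k$ symmetries on $\mathbb{C}^d$. Condition (P): for $d=r+s$ with integers $1\le s\le r$, the numbers $\alpha\ne\beta\in\mathbb{T}$ satisfy Condition (P) if (i) $\alpha^r\beta^s\in\{-1,1\}$, and (ii) whenever $i,j\ge 0$ are integers, not both zero, with $\alpha^i\beta^j\in\{-1,1\}$, then $i+j\ge d$. (In particular $\alpha,\beta\notin\{-1,1\}$.) *)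

(* Defs.v *)
From HB Require Import structures.
From mathcomp Require Import all_boot all_order all_algebra.
From mathcomp Require Import complex.
From mathcomp Require Import reals trigo.

Set Implicit Arguments.
Unset Strict Implicit.
Unset Printing Implicit Defensive.

Import Order.TTheory GRing.Theory Num.Theory.

Local Open Scope ring_scope.
Local Open Scope sesquilinear_scope.
Local Open Scope complex_scope.

Section Definitions.
Variable R : realType.

(* e^{it} for real t *)
Definition expi (t : R) : R[i] := cos t +i* sin t.

(* J = J^* = J^-1; the invertibility requirement is not redundant, since
   [invmx J] is [J] itself when [J] is singular. *)
Definition is_symmetry (d : nat) (J : 'M[R[i]]_d) : Prop :=
  [/\ J \in unitmx, J = J ^t* & J = invmx J].

Definition Sym (k d : nat) (A : 'M[R[i]]_d) : Prop :=
  exists J : 'I_k -> 'M[R[i]]_d,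
    (forall i, is_symmetry (J i)) /\ A = \prod_(i < k) J i.

(* The standing requirements 1 <= s <= r, |alpha| = |beta| = 1 and
   alpha <> beta are not part of the predicate. *)
Definition condition_P (r s : nat) (alpha beta : R[i]) : Prop :=
  (alpha ^+ r * beta ^+ s = -1 \/ alpha ^+ r * beta ^+ s = 1) /\
  (forall i j : nat, ~ (i = 0%N /\ j = 0%N) ->
     (alpha ^+ i * beta ^+ j = -1 \/ alpha ^+ i * beta ^+ j = 1) ->
     (r + s <= i + j)%N).

(* alpha I_r (+) beta I_s *)
Definition two_scalar_mx (r s : nat) (alpha beta : R[i]) : 'M[R[i]]_(r + s) :=
  block_mx alpha%:M 0 0 beta%:M.

End Definitions.

(* Main.v *)
Require Import Defs.
From HB Require Import structures.
From mathcomp Require Import all_boot all_order all_algebra.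
From mathcomp Require Import complex.
From mathcomp Require Import reals trigo.
From mathcomp Require Import ring lra zify.

Set Implicit Arguments.
Unset Strict Implicit.
Unset Printing Implicit Defensive.

Import Order.TTheory GRing.Theory Num.Theory.

Local Open Scope ring_scope.
Local Open Scope complex_scope.

(* V J has the eigenvalue -alpha beta / l along with l, unless l is +-alpha or
   +-beta, and every eigenvalue satisfies |l^2 - alpha beta| <= |alpha - beta|.
   If moreover V J is a product of two symmetries, its spectrum is invariant
   under inversion. Composing the two moves multiplies eigenvalues by
   alpha beta up to sign, and condition (P) lets this walk go on for r steps, so
   a whole coset z mu_r of the group of r-th roots of unity lies at distance at
   most |alpha - beta| from 1; as such a coset meets the arc of half-length
   pi / r around -1, this forces |e^{i pi (r-1)/r} - 1| < |alpha - beta|.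
   Conversely, under this inequality V J can be given the spectrum
   1, w, w^-1, w^2, ..., w^r if w := -alpha beta satisfies w^r = -1, or
   a cycle through i and -i if w^r = 1. Conditions (i), (ii), (iii) all
   amount to this inequality: (P) gives (alpha beta)^r = -1 for even r, and in
   (iii) the coset of alpha / beta is within distance |alpha - beta| of 1. *)

(** * Unit complex numbers and their distance to 1 *)

Section UnitCircle.
Variable R : realType.
Local Notation Re := complex.Re.
Local Notation Im := complex.Im.
Implicit Types (t : R) (z u v : R[i]).

Lemma expi0 : expi 0 = 1 :> R[i].
Proof. by rewrite /expi cos0 sin0. Qed.

Lemma expiD t1 t2 : expi (t1 + t2) = expi t1 * expi t2.
Proof. by rewrite /expi cosD sinD; simpc; congr (_ +i* _); rewrite addrC mulrC. Qed.

Lemma expiMn t n : expi (t *+ n) = expi t ^+ n.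
Proof. by elim: n => [|n IHn]; rewrite ?expi0// mulrS exprS expiD IHn. Qed.

Lemma expi_pi : expi pi = -1 :> R[i].
Proof. by rewrite /expi cospi sinpi; apply/eqP; rewrite eq_complex /= oppr0 !eqxx. Qed.

Lemma norm_expi t : `|expi t| = 1.
Proof. by rewrite normc_def /= cos2Dsin2 sqrtr1. Qed.

Lemma unit_ReIm z : `|z| = 1 -> Re z ^+ 2 + Im z ^+ 2 = 1.
Proof. by move=> hz; have := add_Re2_Im2 z; rewrite hz expr1n => /(congr1 (@Re _)). Qed.

Lemma norm_sub1_sqr z : `|z| = 1 -> `|1 - z| ^+ 2 = (2 - 2 * Re z)%:C.
Proof.
move=> /unit_ReIm hz; rewrite -add_Re2_Im2; congr (_ %:C).
by case: z hz => a b /= hz; nra.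
Qed.

(** As [|1 - z|^2 = 2 - 2 Re z] on the unit circle, distances to 1 are compared through real parts,
    that is, through cosines. *)
Lemma le_norm_sub1 u v : `|u| = 1 -> `|v| = 1 ->
  (`|1 - u| <= `|1 - v|) = (Re v <= Re u).
Proof.
move=> hu hv; rewrite -(@ler_pXn2r _ 2) ?nnegrE ?normr_ge0 //.
by rewrite !norm_sub1_sqr // lecR; apply/idP/idP => h; lra.
Qed.

Lemma lt_norm_sub1 u v : `|u| = 1 -> `|v| = 1 ->
  (`|1 - u| < `|1 - v|) = (Re v < Re u).
Proof.
move=> hu hv; rewrite -(@ltr_pXn2r _ 2) ?nnegrE ?normr_ge0 //.
by rewrite !norm_sub1_sqr // ltcR; apply/idP/idP => h; lra.
Qed.

(** The argument is taken nonnegative so that [Num.truncn] can round it in [Re_coset_le]. *)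
Lemma unit_expi z : `|z| = 1 -> exists2 t, 0 <= t & z = expi t.
Proof.
case: z => a b /unit_ReIm /= hab.
have a1 : -1 <= a <= 1 by apply/andP; split; nra.
have ca : cos (acos a) = a by apply: acosK; rewrite in_itv.
have sa := sin_acos a1.
rewrite (_ : 1 - a ^+ 2 = b ^+ 2) ?sqrtr_sqr in sa; last by rewrite -hab; ring.
have p0 : 0 <= acos a by exact: acos_ge0.
have [b0|b0] := lerP 0 b.
  by exists (acos a) => //; rewrite /expi ca sa ger0_norm.
exists (pi *+ 2 - acos a).
  by have := acos_lepi a1; have := pi_ge0 R; rewrite mulr2n; lra.
rewrite /expi -opprB cosN sinN cosB sinB cos2pi sin2pi ca sa ltr0_norm //.
by congr (_ +i* _); ring.
Qed.

(** * Roots of unity of order [2 * r] and cosets of the group of order [r] *)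

Section Roots.
Variables (r : nat) (r0 : (0 < r)%N).
Let w : R := pi / r%:R.

Let rR : 0 < r%:R :> R. Proof. by rewrite ltr0n. Qed.
Let w_gt0 : 0 < w. Proof. by rewrite divr_gt0 ?pi_gt0. Qed.
Let w_pi : w *+ r = pi.
Proof. by rewrite -[LHS]mulr_natr divfK // gt_eqF. Qed.
Let ler_w m n : (w *+ m <= w *+ n) = (m <= n)%N.
Proof. exact: ler_pMn2l. Qed.
Let in_pi m : (m <= r)%N -> w *+ m \in `[0, pi].
Proof.
move=> h; rewrite in_itv /= mulrn_wge0 ?(ltW w_gt0) //=.
by rewrite -w_pi ler_w.
Qed.

(** Brings angles back to [[0, pi]], where the cosine is injective and decreasing. *)
Lemma cos_mul_reflect m : (r <= m <= 2 * r)%N ->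
  cos (w *+ m) = cos (w *+ (2 * r - m)).
Proof.
move=> /andP[h1 h2]; rewrite mulrnBr // mulnC mulrnA w_pi.
by rewrite cosB cos2pi sin2pi mul0r mul1r addr0.
Qed.

Lemma expi_prim_root : (2 * r).-primitive_root (expi w).
Proof.
apply/andP; split; first by rewrite muln_gt0.
apply/forallP => i; apply/eqP; rewrite unity_rootE.
have [->|ni] := eqVneq i.+1 (2 * r)%N.
  by rewrite mulnC exprM -expiMn w_pi expi_pi sqrrN expr1n eqxx.
apply/negP => /eqP; rewrite -expiMn => -[] h _.
have hi : (i.+1 < 2 * r)%N by have := ltn_ord i; lia.
have [m [m0 mr hm]] : exists m, [/\ (0 < m)%N, (m <= r)%N & cos (w *+ m) = 1].
  have [hr|hr] := leqP i.+1 r; first by exists i.+1.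
  by exists (2 * r - i.+1)%N; rewrite -cos_mul_reflect; [split=> //; lia | lia].
have := cos_inj (in_pi mr) (in_pi (leq0n r)).
by rewrite hm mulr0n cos0 => /(_ erefl) /eqP; rewrite gt_eqF // pmulrn_rgt0.
Qed.

Lemma angle_antipode : (r%:R - 1) / r%:R * pi = w *+ r.-1.
Proof.
rewrite -[RHS]mulr_natr -subn1 natrB // /w; field; by rewrite gt_eqF.
Qed.

(** Index [r] gives [-1]; any other index reflects to one at most [r.-1], and the cosine decreases
    on [[0, pi]]. *)
Lemma Re_root_ge z : z ^+ (2 * r) = 1 -> z <> -1 -> cos (w *+ r.-1) <= Re z.
Proof.
move=> hz nz; have [i zi] := prim_rootP expi_prim_root hz.
have ir : (i != r :> nat).
  apply/eqP => hi; apply: nz; rewrite zi hi -expiMn w_pi; exact: expi_pi.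
have [m mr ->] : exists2 m, (m <= r.-1)%N & Re z = cos (w *+ m).
  rewrite zi -expiMn /=; have [hr|hr] := leqP i r; first by exists i => //; lia.
  by exists (2 * r - i)%N; [|rewrite -cos_mul_reflect //]; have := ltn_ord i; lia.
by rewrite leNgt ltr_cos ?in_pi -?leNgt ?ler_w //; lia.
Qed.

(** The real part determines a unit number up to conjugation. *)
Lemma Re_eq_root z : `|z| = 1 -> Re z = cos (w *+ r.-1) -> z ^+ (2 * r) = 1.
Proof.
move=> /unit_ReIm hz hR.
have hk : expi w ^+ (2 * r) = 1 by apply: prim_expr_order expi_prim_root.
have h1 : expi (w *+ r.-1) ^+ (2 * r) = 1.
  by rewrite expiMn -exprM mulnC exprM hk expr1n.
have : (Im z - sin (w *+ r.-1)) * (Im z + sin (w *+ r.-1)) = 0.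
  by have := cos2Dsin2 (w *+ r.-1); rewrite -hR; nra.
move/eqP; rewrite mulf_eq0 => /orP[] /eqP hI.
  suff -> : z = expi (w *+ r.-1) by [].
  by rewrite /expi -hR -(subr0_eq hI); case: (z).
suff -> : z = (expi (w *+ r.-1))^*%C by rewrite -rmorphXn /= h1 conjc1.
by rewrite /expi -hR /= -(addr0_eq hI) opprK; case: (z).
Qed.

(** Neighbours in the coset differ by the angle [2 w], so one of them lies within [w] of [-1], where
    the real part is at most [cos (pi - w)]. *)
Lemma Re_coset_le (zeta : R[i]) z : r.-primitive_root zeta -> `|z| = 1 ->
  exists2 k, (k < r)%N & Re (z * zeta ^+ k) <= cos (w *+ r.-1).
Proof.
move=> prz hz.
have [|t t0 zt] := @unit_expi (- z); first by rewrite normrN.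
(* Rounds [t / (2 w)] to a nearest integer: adding [w] to [t] adds one half before truncation. *)
pose n := Num.truncn ((t + w) / (w *+ 2)).
have w20 : 0 < w *+ 2 by rewrite pmulrn_rgt0.
have /andP[h1 h2] : n%:R <= (t + w) / (w *+ 2) < n.+1%:R.
  by apply: Num.Theory.truncn_itv; rewrite divr_ge0 // ?addr_ge0 // ltW.
have {}h1 : n%:R * (w *+ 2) <= t + w by rewrite -ler_pdivlMr.
have {}h2 : t + w < n.+1%:R * (w *+ 2) by rewrite -ltr_pdivrMr.
pose x := expi (- (w *+ (2 * n))).
have hx : x ^+ r = 1.
  have : x ^+ r * expi (w *+ (2 * n)) ^+ r = 1.
    by rewrite -exprMn -expiD addNr expi0 expr1n.
  rewrite (_ : expi (w *+ (2 * n)) ^+ r = 1) ?mulr1 //.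
  rewrite -expiMn -mulrnA (_ : 2 * n * r = 2 * r * n)%N; last by lia.
  by rewrite expiMn exprM (prim_expr_order expi_prim_root) expr1n.
have [k xk] := prim_rootP prz hx.
exists k; first exact: ltn_ord.
rewrite -xk -[z]opprK zt mulNr -expiD.
have -> : Re (- expi (t - w *+ (2 * n))) = - cos (t - w *+ (2 * n)) by [].
have -> : cos (w *+ r.-1) = - cos w.
  have -> : w *+ r.-1 = pi - w by rewrite -w_pi -[in RHS](prednK r0) mulrS; ring.
  by rewrite cosB cospi sinpi mul0r addr0 mulN1r.
rewrite lerN2 -(cos_norm (t - _)).
have hle : `|t - w *+ (2 * n)| <= w.
  move: h1 h2; rewrite mulrnA -mulr_natl -[in n.+1%:R]addn1 natrD => h1 h2.
  rewrite ler_norml; apply/andP; split; rewrite -(mulr_natl (w *+ 2) n); lra.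
have wpi : w <= pi by rewrite -[leLHS]mulr1n -w_pi ler_w.
rewrite leNgt ltr_cos -?leNgt //; rewrite in_itv /=.
  by rewrite (ltW w_gt0).
by rewrite normr_ge0 (le_trans hle).
Qed.

End Roots.
End UnitCircle.

(** * Arithmetic consequences of condition (P) *)

Section ConditionP.
Variables (R : realType) (r : nat) (alpha beta : R[i]).
Local Notation Re := complex.Re.
Hypotheses (r2 : (2 <= r)%N) (halpha : `|alpha| = 1) (hbeta : `|beta| = 1).
Hypotheses (hneq : alpha <> beta) (hP : condition_P r r alpha beta).

(** The number compared with 1 on the left is the [2 r]-th root of unity next to [-1]. *)
Definition antipode_gap :=
  `|expi ((r%:R - 1) / r%:R * pi) - 1| < `|alpha - beta|.

Let r0 : (0 < r)%N. Proof. exact: ltnW. Qed.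

Let a0 : alpha != 0. Proof. by rewrite -normr_gt0 halpha. Qed.
Let b0 : beta != 0. Proof. by rewrite -normr_gt0 hbeta. Qed.

(** Squaring treats the values 1 and -1 at once. *)
Lemma condition_P_sqr i j : (alpha ^+ i * beta ^+ j) ^+ 2 = 1 ->
  (0 < i + j)%N -> (2 * r <= i + j)%N.
Proof.
move=> /eqP; rewrite sqrf_eq1 => h ij; rewrite mul2n -addnn; apply: hP.2.
  by case=> i0 j0; rewrite i0 j0 in ij.
by case/orP: h => /eqP ->; [right|left].
Qed.

Lemma prod_pow_r : (alpha * beta) ^+ r = -1 \/ (alpha * beta) ^+ r = 1.
Proof. by rewrite exprMn; exact: hP.1. Qed.

(** Otherwise [(alpha * beta) ^+ r./2] squares to 1, with total degree only [r]. *)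
Lemma prod_pow_even : ~~ odd r -> (alpha * beta) ^+ r = -1.
Proof.
move=> ev; case: prod_pow_r => // h.
have /condition_P_sqr : (alpha ^+ r./2 * beta ^+ r./2) ^+ 2 = 1.
  by rewrite -exprMn -exprM muln2 halfK (negbTE ev) subn0.
by have := even_halfK ev; lia.
Qed.

Lemma prod_sqr_prim_root : r.-primitive_root ((alpha * beta) ^+ 2).
Proof.
apply/andP; split=> //; apply/forallP => i; apply/eqP; rewrite unity_rootE.
have [->|ni] := eqVneq i.+1 r.
  by rewrite exprAC; case: prod_pow_r => ->; rewrite ?sqrrN expr1n eqxx.
apply/negP => /eqP; rewrite exprAC exprMn => /condition_P_sqr.
by have := ltn_ord i; lia.
Qed.

Lemma norm_sub_ratio : `|alpha - beta| = `|1 - alpha / beta|.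
Proof.
have -> : alpha - beta = - beta * (1 - alpha / beta) by field.
by rewrite normrM normrN hbeta mul1r.
Qed.

Lemma norm_ratio : `|alpha / beta| = 1.
Proof. by rewrite normrM normfV halpha hbeta invr1 mul1r. Qed.

Lemma antipode_gapE :
  antipode_gap = (Re (alpha / beta) < cos (pi / r%:R *+ r.-1)).
Proof.
rewrite /antipode_gap norm_sub_ratio distrC angle_antipode //.
by rewrite lt_norm_sub1 ?norm_expi ?norm_ratio.
Qed.

(** Equality makes [alpha / beta] a [2 r]-th root of unity, so [(beta / alpha) ^+ 2] is a power of
    the primitive root [(alpha * beta) ^+ 2], with exponent [a < r]. *)
Lemma ratio_not_extremal : Re (alpha / beta) <> cos (pi / r%:R *+ r.-1).
Proof.
move=> hRe; have hg := Re_eq_root r0 norm_ratio hRe.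
have hg' : ((alpha / beta) ^- 2) ^+ r = 1.
  by rewrite exprVn -exprM hg invr1.
have [a ag] := prim_rootP prod_sqr_prim_root hg'.
have ba : beta ^+ 2 = (alpha * beta) ^+ a ^+ 2 * alpha ^+ 2.
  rewrite exprAC -ag; field; by apply/andP.
(* For [a = 0] only [beta = - alpha] is left, and the ratio [-1] does not have the real part
   assumed. *)
have [az|an] := posnP a.
  move: ba; rewrite az expr0 expr1n mul1r => /eqP; rewrite eqf_sqr.
  case/orP=> [/eqP ba|/eqP ba]; first by case: hneq.
  have h : cos (pi / r%:R *+ r.-1 : R) = cos pi.
    by rewrite -hRe ba invrN mulrN mulfV // cospi.
  have w0 : 0 < pi / r%:R :> R by rewrite divr_gt0 ?pi_gt0 ?ltr0n.
  have wr : pi / r%:R *+ r = pi :> R.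
    by rewrite -mulr_natr divfK // pnatr_eq0 -lt0n.
  have : pi / r%:R *+ r.-1 = pi :> R.
    apply: cos_inj h; rewrite in_itv /=.
      by rewrite mulrn_wge0 ?(ltW w0) //= -[leRHS]wr ler_pMn2l // leq_pred.
    by rewrite pi_ge0 lexx.
  move=> e; have := ltnSn r.-1.
  by rewrite -(ltr_pMn2l w0) prednK // e wr ltxx.
(* The total degree is [2 a < 2 r], against (P). *)
have /condition_P_sqr : (alpha ^+ a.+1 * beta ^+ a.-1) ^+ 2 = 1.
  apply: (@mulIf _ (beta ^+ 2)); first by rewrite expf_neq0.
  rewrite mul1r [RHS]ba -!exprMn; congr (_ ^+ 2).
  by rewrite -mulrA -exprSr prednK // exprMn exprSr mulrAC.
by have := ltn_ord a; lia.
Qed.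

(* Some element of the coset is within pi / r of -1, and equality would force
   alpha / beta to be a 2r-th root of unity, hence +- a power of alpha beta. *)
Lemma antipode_gap_of_coset z : `|z| = 1 ->
  (forall k, (k < r)%N -> `|1 - z * (alpha * beta) ^+ (2 * k)| <= `|alpha - beta|) ->
  antipode_gap.
Proof.
move=> hz hk; have [k kr hc] := Re_coset_le r0 prod_sqr_prim_root hz.
rewrite antipode_gapE lt_neqAle; apply/andP; split.
  by apply/eqP; exact: ratio_not_extremal.
apply: le_trans hc; have := hk k kr.
rewrite norm_sub_ratio le_norm_sub1 ?norm_ratio // exprM //.
by rewrite !normrM !normrX !normrM halpha hbeta hz !(mulr1, expr1n).
Qed.

Lemma antipode_gap_root z : antipode_gap -> z ^+ (2 * r) = 1 -> z <> -1 ->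
  `|1 - z| <= `|alpha - beta|.
Proof.
move=> hC hz nz; have hnz : `|z| = 1.
  by apply/eqP; rewrite -[_ == 1](@pexpr_eq1 _ _ (2 * r)) ?muln_gt0 // -normrX hz normr1.
rewrite norm_sub_ratio le_norm_sub1 ?norm_ratio //; apply: ltW.
by move: hC; rewrite antipode_gapE => /lt_le_trans; apply; exact: Re_root_ge.
Qed.

End ConditionP.

(** * Symmetries and the spectrum of a product of two of them *)

Section Symmetries.
Local Open Scope sesquilinear_scope.
Variables (R : realType) (n : nat).
Local Notation C := R[i].
Implicit Types (A B J W : 'M[C]_n) (v : 'rV[C]_n) (l : C).

Lemma symmetryP J : is_symmetry J <-> J ^t* = J /\ J *m J = 1%:M.
Proof.
split=> [[Ju JJ Ji]|[JJ Ji]].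
  by split=> //; rewrite {2}Ji mulmxV.
have Ju : J \in unitmx by case: (mulmx1_unit Ji).
split=> //; apply: (can_inj (mulKmx Ju)); by rewrite Ji mulmxV.
Qed.

Lemma Sym3P A : Sym 3 A <-> exists J1 J2 J3,
  [/\ is_symmetry J1, is_symmetry J2, is_symmetry J3 & A = J1 *m J2 *m J3].
Proof.
split=> [[J [hJ ->]]|[J1 [J2 [J3 [h1 h2 h3 ->]]]]].
  exists (J ord0), (J (lift ord0 ord0)), (J (lift ord0 (lift ord0 ord0))).
  by split=> //; rewrite !big_ord_recl big_ord0 mulr1 mulrA.
exists (fun i : 'I_3 => if val i is 0 then J1 else if val i is 1 then J2 else J3).
split; first by case=> [[|[|[]]]].
by rewrite !big_ord_recl big_ord0 /= mulr1 mulrA.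
Qed.

Lemma symmetry_conj W J : W \is unitarymx -> is_symmetry J ->
  is_symmetry (W ^t* *m J *m W).
Proof.
move=> uW /symmetryP[JJ Ji]; apply/symmetryP; split.
  by rewrite !trmx_mul !map_mxM trmxCK JJ mulmxA.
rewrite !mulmxA mulmxtVK // -(mulmxA _ J J) Ji mulmx1.
by apply: mulmx1C; apply/unitarymxP.
Qed.

Lemma Sym3_conj W A : W \is unitarymx -> Sym 3 A -> Sym 3 (W ^t* *m A *m W).
Proof.
move=> uW /Sym3P[J1 [J2 [J3 [h1 h2 h3 ->]]]]; apply/Sym3P.
exists (W ^t* *m J1 *m W), (W ^t* *m J2 *m W), (W ^t* *m J3 *m W).
by split; try exact: symmetry_conj; rewrite !mulmxA !mulmxtVK.
Qed.

Definition sqnorm v : C := (v *m v ^t*) 0 0.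

Lemma sqnorm_gt0 v : v != 0 -> 0 < sqnorm v.
Proof. by move=> v0; rewrite /sqnorm -dotmxE dnorm_gt0. Qed.

Lemma sqnorm_ge0 v : 0 <= sqnorm v.
Proof. by rewrite /sqnorm -dotmxE dnorm_ge0. Qed.

Lemma symmetry_neq0 J v : is_symmetry J -> v != 0 -> v *m J != 0.
Proof.
move=> /symmetryP[_ Ji]; apply: contraNneq => h.
by rewrite -[v]mulmx1 -Ji mulmxA h mul0mx.
Qed.

Lemma eigen_norm1 A v l : A *m A ^t* = 1%:M -> v != 0 -> v *m A = l *: v ->
  `|l| = 1.
Proof.
move=> uA v0 hv.
have : (v *m A) *m (v *m A) ^t* = v *m v ^t*.
  by rewrite trmx_mul map_mxM mulmxA -(mulmxA v) uA mulmx1.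
rewrite hv linearZ /= map_mxZ -scalemxAl -scalemxAr scalerA.
move=> /(congr1 (fun M : 'M_1 => M 0 0)); rewrite mxE -/(sqnorm v) => h.
have /lt0r_neq0 q0 := sqnorm_gt0 v0.
have : l * l^*%R = 1 by apply: (mulIf q0); rewrite mul1r.
by rewrite -normCK => /eqP; rewrite sqrp_eq1 // => /eqP.
Qed.

(** Conjugation by [J2] turns [J1 *m J2] into [J2 *m J1], its inverse; hence [v *m J2] is an
    eigenvector for [l^-1]. *)
Lemma eigenvalue_prod_symmetry J1 J2 l : is_symmetry J1 -> is_symmetry J2 ->
  eigenvalue (J1 *m J2) l -> `|l| = 1 /\ eigenvalue (J1 *m J2) l^-1.
Proof.
move=> s1 s2 /eigenvalueP[v hv v0].
have [[J1J J1i] [J2J J2i]] := ((symmetryP J1).1 s1, (symmetryP J2).1 s2).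
have l1 : `|l| = 1.
  apply: eigen_norm1 v0 hv.
  by rewrite trmx_mul map_mxM J1J J2J !mulmxA -(mulmxA J1) J2i mulmx1.
have l0 : l != 0 by rewrite -normr_gt0 l1.
split=> //; apply/eigenvalueP; exists (v *m J2); last exact: symmetry_neq0.
have h : v *m J1 = l *: (v *m J2).
  by rewrite scalemxAl -hv -!mulmxA J2i mulmx1.
by rewrite mulmxA -[in LHS](scalerK l0 (v *m J2)) -h -!scalemxAl -(mulmxA v) J1i mulmx1.
Qed.

End Symmetries.

(** * Eigenvalues of [V *m J] for a single symmetry [J] *)

Section Compression.
Local Open Scope sesquilinear_scope.
Variables (R : realType) (r : nat) (alpha beta : R[i]).
Local Notation C := R[i].
Hypotheses (halpha : `|alpha| = 1) (hbeta : `|beta| = 1).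
Local Notation V := (two_scalar_mx r r alpha beta).
Implicit Types (J : 'M[C]_(r + r)) (v : 'rV[C]_(r + r)) (l : C).

Let a0 : alpha != 0. Proof. by rewrite -normr_gt0 halpha. Qed.
Let b0 : beta != 0. Proof. by rewrite -normr_gt0 hbeta. Qed.

Lemma two_scalar_mx_quadratic :
  V *m V = (alpha + beta) *: V - (alpha * beta)%:M.
Proof.
rewrite /two_scalar_mx mulmx_block !mulmx0 !mul0mx !addr0 add0r -!scalar_mxM.
rewrite scale_block_mx !scaler0 (scalar_mx_block r r (alpha * beta)).
rewrite opp_block_mx add_block_mx !scale_scalar_mx -!raddfB /= subr0.
by congr block_mx; congr _%:M; ring.
Qed.

Lemma eigen_two_scalar_mx v l : v != 0 -> v *m V = l *: v ->
  (l == alpha) || (l == beta).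
Proof.
move=> v0 hv; have : v *m (V *m V) = l ^+ 2 *: v.
  by rewrite mulmxA hv -scalemxAl hv scalerA.
rewrite two_scalar_mx_quadratic mulmxBr -scalemxAr hv mul_mx_scalar.
rewrite scalerA -scalerBl => /eqP; rewrite -subr_eq0 -scalerBl scaler_eq0.
rewrite (negbTE v0) orbF => /eqP h.
have : (l - alpha) * (l - beta) = 0 by rewrite -[RHS]oppr0 -h; ring.
by move/eqP; rewrite mulf_eq0 !subr_eq0.
Qed.

(** The span of [v] and [v *m J] is invariant under [V *m J], which acts on it triangularly with
    diagonal [l], [mu]. *)
Lemma eigen_partner J l : is_symmetry J -> `|l| = 1 -> eigenvalue (V *m J) l ->
  l ^+ 2 != alpha ^+ 2 -> l ^+ 2 != beta ^+ 2 ->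
  eigenvalue (V *m J) (- (alpha * beta / l)).
Proof.
move=> /[dup] sJ /symmetryP[JJ Ji] l1 hl la lb.
have l0 : l != 0 by rewrite -normr_gt0 l1.
set mu := - _; have [->//|lmu] := eqVneq mu l.
move: hl => /eigenvalueP[v hv v0].
have hV : v *m V = l *: (v *m J).
  by rewrite scalemxAl -hv -!mulmxA Ji mulmx1.
have hJ : (v *m J) *m (V *m J) = (alpha + beta) *: v + mu *: (v *m J).
  apply: (scalerI l0); rewrite mulmxA scalemxAl (scalemxAl l) -hV -(mulmxA v V).
  rewrite two_scalar_mx_quadratic mulmxBr mulmxBl -scalemxAr -scalemxAl.
  rewrite -(mulmxA v V J) hv mul_mx_scalar -scalemxAl scalerDr !scalerA.
  rewrite (mulrC _ l) -scaleNr; congr (_ + _ *: _).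
  by rewrite /mu; field.
pose t := (alpha + beta) / (mu - l).
have ml : mu - l != 0 by rewrite subr_eq0.
apply/eigenvalueP; exists (v *m J + t *: v).
  rewrite mulmxDl hJ -scalemxAl hv scalerDr addrAC addrC; congr (_ + _).
  by rewrite !scalerA -scalerDl; congr (_ *: _); rewrite /t; field.
(* If the candidate vanishes, [v] is an eigenvector of [J], hence of [V], so [l] is [alpha] or
   [beta] up to sign. *)
apply/eqP => hz; have hvJ : v *m J = - t *: v.
  by rewrite scaleNr; apply/eqP; rewrite -addr_eq0 hz.
have tt : t ^+ 2 = 1.
  have : v *m (J *m J) = t ^+ 2 *: v.
    by rewrite mulmxA hvJ -scalemxAl hvJ scalerA mulrNN.
  rewrite Ji mulmx1 -[in LHS](scale1r v) => /eqP.
  by rewrite -subr_eq0 -scalerBl scaler_eq0 (negbTE v0) orbF subr_eq0 => /eqP.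
have : v *m V = (l * - t) *: v by rewrite hV hvJ scalerA.
move=> /(eigen_two_scalar_mx v0) /orP[] /eqP h.
  by case/eqP: la; rewrite -h exprMn sqrrN tt mulr1.
by case/eqP: lb; rewrite -h exprMn sqrrN tt mulr1.
Qed.

(* Multiply v V = l v J by v* on the right: v J v* is real, and v V v* lies on
   the segment joining alpha and beta scaled by the squared norm of v. *)
Lemma eigen_bound J l : is_symmetry J -> `|l| = 1 -> eigenvalue (V *m J) l ->
  `|l ^+ 2 - alpha * beta| <= `|alpha - beta|.
Proof.
move=> /symmetryP[JJ Ji] l1 /eigenvalueP[v hv v0].
have l0 : l != 0 by rewrite -normr_gt0 l1.
have inv (u : C) : `|u| = 1 -> u^*%R = u^-1 by move=> u1; rewrite invC_norm u1 expr1n invr1 mul1r.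
have hV : v *m V = l *: (v *m J).
  by rewrite scalemxAl -hv -!mulmxA Ji mulmx1.
set c := (v *m J *m v ^t*) 0 0.
have c_real : c^*%R = c.
  have h : (v *m J *m v ^t*) ^t* = v *m J *m v ^t* by rewrite !trmx_mul !map_mxM trmxCK JJ mulmxA.
  by rewrite /c -[in RHS]h [RHS]mxE [in RHS]mxE.
pose p := sqnorm (lsubmx v); pose q := sqnorm (rsubmx v).
have hc : alpha * p + beta * q = l * c.
  transitivity ((v *m V *m v ^t*) 0 0); last by rewrite hV -scalemxAl mxE.
  rewrite -[v]hsubmxK tr_row_mx map_col_mx /two_scalar_mx mul_row_block.
  by rewrite !mulmx0 addr0 add0r mul_row_col mxE !mul_mx_scalar -!scalemxAl;
    congr (_ + _); rewrite mxE.
have p0 : 0 <= p by exact: sqnorm_ge0.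
have q0 : 0 <= q by exact: sqnorm_ge0.
have pR : p^*%R = p by apply/CrealP; exact: ger0_real.
have qR : q^*%R = q by apply/CrealP; exact: ger0_real.
have pq : 0 < p + q.
  have := sqnorm_gt0 v0; rewrite -[v]hsubmxK /sqnorm tr_row_mx map_col_mx mul_row_col.
  by rewrite mxE.
have hc' : alpha^-1 * p + beta^-1 * q = l^-1 * c.
  rewrite -(inv alpha) // -(inv beta) // -(inv l) // -[in LHS]pR -[in LHS]qR -[in RHS]c_real.
  by rewrite -!rmorphM -rmorphD hc.
(* Combines [hc] with its conjugate [hc']. The bound follows on taking norms, since
   [|p - q| <= |alpha p + beta q| = |c|]. *)
have key : c * (l ^+ 2 - alpha * beta) = l * (p - q) * (alpha - beta).
  have -> : c * (l ^+ 2 - alpha * beta) = l * (l * c) - alpha * beta * l * (l^-1 * c).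
    by field.
  by rewrite -hc -hc'; field; rewrite a0 b0.
have cn : `|c| = `|alpha * p + beta * q| by rewrite hc normrM l1 mul1r.
have cge : `|p - q| <= `|c|.
  have := ler_dist_normD (alpha * p) (beta * q).
  by rewrite -cn !normrM halpha hbeta !mul1r (ger0_norm p0) (ger0_norm q0).
have := congr1 Num.norm key; rewrite !normrM l1 mul1r => nk.
(* Nothing can be cancelled when [c = 0]; but then [p = q] and [beta = - alpha], so the right side
   is 2. *)
have [c0|cn0] := eqVneq c 0.
  have pq_eq : p = q.
    by apply/eqP; rewrite -subr_eq0 -normr_le0 -[leRHS](normr0 C) -c0.
  have ab : beta = - alpha.
    apply/eqP; rewrite -addr_eq0 addrC; apply/eqP.
    have p_neq0 : p != 0 by move: pq; rewrite -pq_eq -mulr2n pmulrn_lgt0 // => /gt_eqF ->.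
    by apply: (mulIf p_neq0); rewrite mul0r mulrDl {2}pq_eq hc c0 mulr0.
  have -> : `|alpha - beta| = `|l ^+ 2| + `|alpha * beta|.
    by rewrite normrX normrM halpha hbeta l1 ab opprK -mulr2n normrMn halpha expr1n mulr1.
  exact: ler_normB.
have c_gt0 : 0 < `|c| by rewrite normr_gt0.
by rewrite -(ler_pM2l c_gt0) nk ler_wpM2r.
Qed.

End Compression.

(** * From three symmetries to the inequality, by a walk on eigenvalues *)

Section Necessity.
Variables (R : realType) (r : nat) (alpha beta : R[i]).
Local Notation C := R[i].
Hypotheses (r2 : (2 <= r)%N) (halpha : `|alpha| = 1) (hbeta : `|beta| = 1).
Hypotheses (hneq : alpha <> beta) (hP : condition_P r r alpha beta).
Local Notation V := (two_scalar_mx r r alpha beta).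
Implicit Types (J : 'M[C]_(r + r)) (l : C).

Let a0 : alpha != 0. Proof. by rewrite -normr_gt0 halpha. Qed.
Let b0 : beta != 0. Proof. by rewrite -normr_gt0 hbeta. Qed.
Let ab1 : `|alpha * beta| = 1. Proof. by rewrite normrM halpha hbeta mul1r. Qed.

(** Forgetting signs turns the partner into [alpha * beta / l]; nothing is lost because
    [eigen_bound] depends only on [l ^+ 2]. *)
Definition eigen_upto_sign (A : 'M[C]_(r + r)) l := eigenvalue A l || eigenvalue A (- l).

Lemma eigen_upto_signN A l : eigen_upto_sign A (- l) = eigen_upto_sign A l.
Proof. by rewrite /eigen_upto_sign opprK; exact: orbC. Qed.

(** Dividing [eigen_bound] by [alpha * beta] along the walk gives the coset of
    [l ^+ 2 / (alpha * beta)]. *)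
Lemma antipode_gap_of_walk J l : is_symmetry J -> `|l| = 1 ->
  (forall k, (k < r)%N -> eigen_upto_sign (V *m J) ((alpha * beta) ^+ k * l)) ->
  antipode_gap r alpha beta.
Proof.
move=> sJ l1 hl.
apply: (antipode_gap_of_coset (z := l ^+ 2 / (alpha * beta)) r2 halpha hbeta hneq hP).
  by rewrite normrM normfV normrX l1 ab1 expr1n divr1.
move=> k kr.
have -> : `|1 - l ^+ 2 / (alpha * beta) * (alpha * beta) ^+ (2 * k)| =
          `|((alpha * beta) ^+ k * l) ^+ 2 - alpha * beta|.
  rewrite -[LHS]mul1r -[X in X * _ = _]ab1 -normrM distrC; congr `|_|.
  rewrite [in RHS]exprMn -exprM (mulnC k).
  by move: (_ ^+ (2 * k)) => x; field; apply/andP.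
have n1 : `|(alpha * beta) ^+ k * l| = 1 by rewrite normrM normrX ab1 l1 expr1n mulr1.
have /orP[h|h] := hl k kr; first exact: eigen_bound h.
by rewrite -sqrrN; apply: eigen_bound h; rewrite ?normrN.
Qed.

(* Inverting an element and taking its partner multiplies it by alpha beta; the
   walk stops only next to +-alpha or +-beta, and condition (P) keeps a walk
   started there away from them for r steps. *)
Lemma long_walk (T : pred C) :
  (forall l, T (- l) = T l) -> (forall l, T l -> `|l| = 1) ->
  (forall l, T l -> T l^-1) ->
  (forall l, T l -> l ^+ 2 != alpha ^+ 2 -> l ^+ 2 != beta ^+ 2 ->
     T (alpha * beta / l)) ->
  (exists l, T l) ->
  exists2 l, T l & forall k, (k < r)%N -> T ((alpha * beta) ^+ k * l).
Proof.
move=> TN T1 TV TP [m Tm].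
have Tstep l : T l -> (l ^+ 2 * alpha ^+ 2 != 1) -> (l ^+ 2 * beta ^+ 2 != 1) ->
    T (alpha * beta * l).
  move=> Tl la lb; rewrite -[X in _ * X]invrK.
  have l0 : l != 0 by rewrite -normr_gt0 (T1 _ Tl).
  have sw x : (l^-1 ^+ 2 == x) = (l ^+ 2 * x == 1).
    by rewrite exprVn eq_sym -(inj_eq (mulfI (expf_neq0 2 l0))) mulfV ?expf_neq0.
  by apply: TP; rewrite ?sw //; exact: TV.
have walk l : T l -> (forall k, (k.+1 < r)%N ->
    ((alpha * beta) ^+ k * l) ^+ 2 * alpha ^+ 2 != 1 /\
    ((alpha * beta) ^+ k * l) ^+ 2 * beta ^+ 2 != 1) ->
    exists2 l, T l & forall k, (k < r)%N -> T ((alpha * beta) ^+ k * l).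
  move=> Tl hk; exists l => //; elim=> [|k IHk] kr; first by rewrite expr0 mul1r.
  have [h1 h2] := hk k kr.
  by rewrite exprS -mulrA; apply: Tstep => //; apply: IHk; exact: ltnW.
have Pne i j : (0 < i + j < 2 * r)%N -> (alpha ^+ i * beta ^+ j) ^+ 2 != 1.
  by move=> /andP[h1 h2]; apply/eqP => /(condition_P_sqr hP) /(_ h1); lia.
(* From [alpha] or [beta], an obstruction at step [k] would be a relation of total degree
   [2 k + 2 < 2 r]. *)
have [Ta|Ta] := boolP (T alpha).
  apply: walk Ta _ => k kr; rewrite -!exprMn.
  have -> : (alpha * beta) ^+ k * alpha * alpha = alpha ^+ k.+2 * beta ^+ k.
    by rewrite !exprS exprMn; ring.
  have -> : (alpha * beta) ^+ k * alpha * beta = alpha ^+ k.+1 * beta ^+ k.+1.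
    by rewrite !exprS exprMn; ring.
  by split; apply: Pne; lia.
have [Tb|Tb] := boolP (T beta).
  apply: walk Tb _ => k kr; rewrite -!exprMn.
  have -> : (alpha * beta) ^+ k * beta * beta = alpha ^+ k * beta ^+ k.+2.
    by rewrite !exprS exprMn; ring.
  have -> : (alpha * beta) ^+ k * beta * alpha = alpha ^+ k.+1 * beta ^+ k.+1.
    by rewrite !exprS exprMn; ring.
  by split; apply: Pne; lia.
(* If [T] contains neither [alpha] nor [beta], the walk meets no obstruction and may start
   anywhere. *)
have nT x l : ~~ T x -> T l -> l ^+ 2 * x ^+ 2 != 1.
  move=> nTx Tl; rewrite -exprMn sqrf_eq1; apply: contra nTx.
  have l0 : l != 0 by rewrite -normr_gt0 (T1 _ Tl).
  case/orP=> /eqP h; have -> : x = l^-1 * (l * x) by rewrite mulKf.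
    by rewrite h mulr1; exact: TV.
  by rewrite h mulrN1; rewrite TN; exact: TV.
exists m => //; elim=> [|k IHk] kr; first by rewrite expr0 mul1r.
have {}IHk := IHk (ltnW kr).
by rewrite exprS -mulrA; apply: Tstep => //; exact: nT.
Qed.

(** Moving the third symmetry across makes [V *m J] a product of two symmetries, so both moves of
    the walk are available. *)
Lemma Sym3_antipode_gap : Sym 3 V -> antipode_gap r alpha beta.
Proof.
move=> /Sym3P[J1 [J2 [J [s1 s2 sJ VE]]]].
have UE : V *m J = J1 *m J2.
  by have [_ Ji] := (symmetryP J).1 sJ; rewrite VE -mulmxA Ji mulmx1.
have T1 l : eigen_upto_sign (V *m J) l -> `|l| = 1.
  rewrite /eigen_upto_sign UE => /orP[] /(eigenvalue_prod_symmetry s1 s2)[] //.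
  by rewrite normrN.
have [||||l Tl hl] := @long_walk (eigen_upto_sign (V *m J)) _ T1.
- exact: eigen_upto_signN.
- move=> l; rewrite /eigen_upto_sign UE -invrN.
  case/orP => /(eigenvalue_prod_symmetry s1 s2)[_ h]; apply/orP; first by left.
  by right.
- move=> l Tl la lb; have l1 := T1 _ Tl; case/orP: Tl => h; apply/orP.
    by right; exact: eigen_partner.
  left; have := eigen_partner sJ _ h.
  by rewrite normrN sqrrN invrN mulrN opprK; apply.
- have n0 : (0 < r + r)%N by lia.
  have [l hl] := eigenvalue_closed (V *m J) n0.
  by exists l; apply/orP; left.
by apply: antipode_gap_of_walk sJ (T1 _ Tl) hl.
Qed.

End Necessity.

(** * Three symmetries built from a suitably paired spectrum *)

Section Construction.
Local Open Scope sesquilinear_scope.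
Variable R : realType.
Local Notation C := R[i].

Lemma unit_conjC (u : C) : `|u| = 1 -> u^*%R = u^-1.
Proof. by move=> u1; rewrite invC_norm u1 expr1n invr1 mul1r. Qed.

Section Monomial.
Variables (n : nat) (tau : 'I_n -> 'I_n) (tauK : involutive tau).
Implicit Types e : 'I_n -> C.

Definition monomial_mx e : 'M[C]_n := \matrix_(i, j) ((j == tau i)%:R * e j).

Lemma mul_monomial_mx e f :
  monomial_mx e *m monomial_mx f = diag_mx (\row_i (e (tau i) * f i)).
Proof.
apply/matrixP => i j; rewrite !mxE (bigD1 (tau i)) //= big1 => [|k ki].
  rewrite !mxE eqxx mul1r addr0 tauK eq_sym.
  by case: eqVneq => [->|_]; rewrite ?mul1r ?mulr1n // mul0r mulr0 mulr0n.
by rewrite !mxE (negbTE ki) !mul0r.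
Qed.

(** The inversion rule serves twice: it gives self-adjointness, since conjugates of unit numbers are
    inverses, and it makes the square 1. *)
Lemma monomial_symmetry e : (forall i, `|e i| = 1) ->
  (forall i, e (tau i) = (e i)^-1) -> is_symmetry (monomial_mx e).
Proof.
move=> e1 eV; apply/symmetryP; split.
  apply/matrixP => i j; rewrite !mxE rmorphM rmorph_nat /= unit_conjC // -eV.
  rewrite -(can2_eq tauK tauK) eq_sym.
  by case: eqVneq => [->|_]; rewrite ?tauK ?mul0r.
rewrite mul_monomial_mx -[RHS]diag_const_mx; congr diag_mx.
apply/rowP => i; rewrite !mxE eV mulVf // -normr_gt0 e1 //.
Qed.

(* diag(e) = P (P diag(e)) with P the permutation matrix of tau. *)
Lemma diag_prod_symmetries e : (forall i, `|e i| = 1) ->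
  (forall i, e (tau i) = (e i)^-1) ->
  exists J1 J2, [/\ is_symmetry J1, is_symmetry J2 & diag_mx (\row_i e i) = J1 *m J2].
Proof.
move=> e1 eV; exists (monomial_mx (fun=> 1)), (monomial_mx e); split.
- by apply: monomial_symmetry => i; rewrite ?normr1 ?invr1.
- exact: monomial_symmetry.
by rewrite mul_monomial_mx; congr diag_mx; apply/rowP => i; rewrite !mxE mul1r.
Qed.

End Monomial.

(** * Unitary matrices determined by two eigenvalues and the trace *)

Section UnitaryTwoValues.
Import perm.
Variables (r : nat) (alpha beta : C).
Hypothesis hneq : alpha <> beta.

Let ab0 : alpha - beta != 0.
Proof. by rewrite subr_eq0; apply/eqP. Qed.

Let two_valued (s : seq C) := all (fun x => (x == alpha) || (x == beta)) s.

Lemma sum_two_values s : two_valued s ->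
  \sum_(x <- s) x = (alpha - beta) *+ count_mem alpha s + beta *+ size s.
Proof.
elim: s => [|x s IHs] /=; first by rewrite big_nil !mulr0n addr0.
case/andP=> hx /IHs {}IHs; rewrite big_cons IHs mulrnDr mulrS.
have -> : x = (alpha - beta) *+ (x == alpha) + beta.
  case: eqVneq hx => [->|_] /=; first by rewrite mulr1n subrK.
  by move=> /eqP ->; rewrite add0r.
have -> : ((alpha - beta) *+ (x == alpha) + beta == alpha) = (x == alpha).
  case: eqVneq hx => [->|_] /=; first by rewrite mulr1n subrK eqxx.
  by rewrite mulr0n add0r => _; apply/negbTE; rewrite eq_sym -subr_eq0.
by rewrite addrACA.
Qed.

Lemma two_valued_canonical s : two_valued s ->
  perm_eq (nseq (count_mem alpha s) alpha ++ nseq (size s - count_mem alpha s) beta) s.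
Proof.
move=> /allP hs.
suff -> : nseq (count_mem alpha s) alpha ++ nseq (size s - count_mem alpha s) beta =
    [seq x <- s | pred1 alpha x] ++ [seq x <- s | predC (pred1 alpha) x].
  by rewrite perm_filterC.
congr (_ ++ _); rewrite -?(count_predC (pred1 alpha) s) ?addKn -size_filter.
  by apply/esym/all_pred1P; exact: filter_all.
apply/esym/all_pred1P/allP => x.
by rewrite mem_filter /= => /andP[/negbTE xa /hs]; rewrite xa.
Qed.

(** As [alpha - beta] is nonzero in characteristic zero, the sum and the length determine the
    multiplicity of [alpha]. *)
Lemma two_valued_perm_eq s t : two_valued s -> two_valued t -> size s = size t ->
  \sum_(x <- s) x = \sum_(x <- t) x -> perm_eq s t.
Proof.
move=> hs ht st; rewrite !sum_two_values // st => /addIr /(mulrIn ab0) cst.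
have := two_valued_canonical hs; rewrite cst st perm_sym => /perm_trans; apply.
exact: two_valued_canonical.
Qed.

Let dv : 'rV[C]_(r + r) := row_mx (const_mx alpha) (const_mx beta).

Let two_scalar_mxE : two_scalar_mx r r alpha beta = diag_mx dv.
Proof. by rewrite diag_mx_row !diag_const_mx. Qed.

(* By the spectral theorem A is unitarily diagonal with entries in
   {alpha, beta}, and its trace counts each of them r times. *)
Lemma unitary_two_values (A : 'M[C]_(r + r)) : A \is unitarymx ->
  A *m A = (alpha + beta) *: A - (alpha * beta)%:M ->
  \tr A = (alpha + beta) *+ r ->
  exists2 W, W \is unitarymx & A = W ^t* *m two_scalar_mx r r alpha beta *m W.
Proof.
move=> uA qA tA; have nA : A \is normalmx.
  apply/normalmxP; have /unitarymxP h := uA; rewrite h.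
  by apply/esym/mulmx1C.
have [Pu uP] := (spectral_unit A, spectral_unitarymx A).
have /orthomx_spectralP /= := nA.
move: (spectralmx A) (spectral_diag A) Pu uP => P sp Pu uP AE.
have AP : P *m A = diag_mx sp *m P by rewrite AE -!mulmxA (mulKVmx Pu).
have spE i : (sp 0 i == alpha) || (sp 0 i == beta).
  have := congr1 (mulmx P) qA; rewrite mulmxBr -scalemxAr mulmxA AP -mulmxA AP.
  rewrite mulmxA mul_mx_scalar -(mul_scalar_mx (alpha * beta)) scalemxAl -mulmxBl.
  move=> /(can_inj (mulmxK Pu)).
  rewrite mulmx_diag => /(congr1 (fun M : 'M_(r + r) => M i i)).
  rewrite !mxE eqxx !mulr1n => h.
  rewrite -[sp 0 i == alpha]subr_eq0 -[sp 0 i == beta]subr_eq0 -mulf_eq0; apply/eqP.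
  transitivity (sp 0 i * sp 0 i - ((alpha + beta) * sp 0 i - alpha * beta)).
    by ring.
  by rewrite h subrr.
have tsp : \sum_i sp 0 i = \sum_i dv 0 i.
  rewrite -!mxtrace_diag -two_scalar_mxE mxtrace_block !mxtrace_scalar.
  by rewrite -mulrnDl -tA AE mxtrace_mulC mulmxA mulmxV // mul1mx.
have /tuple_permP[p pE] : perm_eq [tuple sp 0 i | i < r + r] [tuple dv 0 i | i < r + r].
  apply: two_valued_perm_eq; rewrite ?size_tuple //.
  - by apply/allP => x /mapP[i _ ->].
  - apply/allP => x /mapP[i _ ->]; rewrite mxE; case: split => k;
    by rewrite mxE eqxx ?orbT.
  - by rewrite !big_tuple; under eq_bigr do rewrite tnth_mktuple;
    under [RHS]eq_bigr do rewrite tnth_mktuple.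
have spp i : sp 0 i = dv 0 (p i).
  by rewrite -(tnth_mktuple (fun i => sp 0 i)) (val_inj pE) !tnth_mktuple.
have dE : diag_mx sp = perm_mx p *m diag_mx dv *m (perm_mx p)^T.
  rewrite tr_perm_mx -row_permE -col_permE; apply/matrixP => i j.
  rewrite [LHS]mxE spp [RHS]mxE [RHS]mxE [RHS]mxE (inj_eq perm_inj) //.
exists ((perm_mx p)^T *m P).
  apply: mul_unitarymx uP; apply/unitarymxP.
  by rewrite trmxK map_perm_mx tr_perm_mx -perm_mxM mulVg perm_mx1.
rewrite [LHS]AE (invmx_unitary uP) dE two_scalar_mxE trmx_mul map_mxM trmxK.
by rewrite map_perm_mx -!mulmxA.
Qed.

End UnitaryTwoValues.

(** * Reflections in the planes of paired eigenvalues *)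

Section Pairs.
Variables (r : nat) (alpha beta : C).
Hypotheses (halpha : `|alpha| = 1) (hbeta : `|beta| = 1) (hneq : alpha <> beta).

Let a0 : alpha != 0. Proof. by rewrite -normr_gt0 halpha. Qed.
Let b0 : beta != 0. Proof. by rewrite -normr_gt0 hbeta. Qed.

Lemma parallelogram_unit (u v : C) : `|u| = 1 -> `|v| = 1 ->
  `|u + v| ^+ 2 + `|u - v| ^+ 2 = 4.
Proof.
move=> u1 v1; rewrite !normCK rmorphD rmorphB /= !unit_conjC //.
by field; rewrite -!normr_gt0 u1 v1 ltr01.
Qed.

(* The entry of the reflection [[a, b], [b, -a]] which, multiplied by
   diag(l, m), has eigenvalues alpha and beta; when l = m the division by zero
   returns 0, which is right since then alpha + beta = 0. *)
Definition pair_cos (l m : C) := (alpha + beta) / (l - m).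
Definition pair_sin (l m : C) := sqrtC (1 - pair_cos l m ^+ 2).

Section Pair.
Variables (l m : C) (l1 : `|l| = 1) (lm : l * m = - (alpha * beta)).
Hypothesis hlm : `|l + m| <= `|alpha - beta|.

Let m1 : `|m| = 1.
Proof.
by have := congr1 Num.norm lm; rewrite normrN !normrM halpha hbeta l1 !mul1r.
Qed.

Let l0 : l != 0. Proof. by rewrite -normr_gt0 l1. Qed.
Let m0 : m != 0. Proof. by rewrite -normr_gt0 m1. Qed.

(** The parallelogram law gives both pairs the same sum of squares, 4, so the bound on [l + m]
    becomes one on [l - m]. *)
Lemma pair_dist : `|alpha + beta| <= `|l - m|.
Proof.
rewrite -(@ler_pXn2r _ 2) ?nnegrE ?normr_ge0 //.
have := parallelogram_unit l1 m1; have := parallelogram_unit halpha hbeta.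
move=> <- /eqP; rewrite -subr_eq => /eqP <-.
by rewrite lerBlDr [leRHS]addrC -lerBlDr addrK ler_pXn2r ?nnegrE ?normr_ge0.
Qed.

Lemma pair_cosE : pair_cos l m * (l - m) = alpha + beta.
Proof.
have [e|ne] := eqVneq (l - m) 0; last by rewrite divfK.
have := pair_dist; rewrite e normr0 normr_le0 mulr0 => /eqP -> //.
Qed.

(** Conjugation divides both [alpha + beta] and, since [l * m = - (alpha * beta)], also [l - m] by
    [alpha * beta]. *)
Lemma pair_cos_real : pair_cos l m \is Num.real.
Proof.
have [e|ne] := eqVneq (l - m) 0; first by rewrite /pair_cos e invr0 mulr0 real0.
apply/CrealP; rewrite /pair_cos fmorph_div rmorphD rmorphB /= !unit_conjC //.
have mE : m = - (alpha * beta) / l by rewrite -lm; field.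
have ne' : l * l + alpha * beta != 0.
  apply: contraNneq ne => h; rewrite mE; apply/eqP.
  by apply: (mulfI l0); rewrite mulr0 -[RHS]h; field.
by rewrite mE; field; rewrite a0 b0 l0 opprK ne' mulNr -opprD oppr_eq0 addrC ne'.
Qed.

Lemma pair_cos_le1 : 0 <= 1 - pair_cos l m ^+ 2.
Proof.
rewrite subr_ge0 -(real_normK pair_cos_real) expr_le1 ?normr_ge0 //.
rewrite /pair_cos normrM normfV.
have [e|ne] := eqVneq (l - m) 0; first by rewrite e normr0 invr0 mulr0.
by rewrite ler_pdivrMr ?normr_gt0 // mul1r pair_dist.
Qed.

Lemma pair_sin_real : pair_sin l m \is Num.real.
Proof. by rewrite ger0_real // sqrtC_ge0 pair_cos_le1. Qed.

End Pair.

Section Sym3.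
Variables (lam mu : 'I_r -> C) (tau : 'I_r + 'I_r -> 'I_r + 'I_r).
(** Indexing by a disjoint sum lets [tau], which matches inverse eigenvalues, be defined by
    cases. *)
Let ev (s : 'I_r + 'I_r) := match s with inl k => lam k | inr k => mu k end.
Hypotheses (lam1 : forall k, `|lam k| = 1).
Hypotheses (lam_mu : forall k, lam k * mu k = - (alpha * beta)).
Hypotheses (hbound : forall k, `|lam k + mu k| <= `|alpha - beta|).
Hypotheses (tauK : involutive tau) (evV : forall s, ev (tau s) = (ev s)^-1).

Let dg (f : 'I_r -> C) : 'M[C]_r := diag_mx (\row_k f k).
Let dgM f g : dg f *m dg g = dg (fun k => f k * g k).
Proof. by rewrite /dg mulmx_diag; congr diag_mx; apply/rowP => k; rewrite !mxE. Qed.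
Let dgD f g : dg f + dg g = dg (fun k => f k + g k).
Proof. by rewrite /dg -raddfD; congr diag_mx; apply/rowP => k; rewrite !mxE. Qed.
Let dgB f g : dg f - dg g = dg (fun k => f k - g k).
Proof. by rewrite /dg -raddfB; congr diag_mx; apply/rowP => k; rewrite !mxE. Qed.
Let dgZ a f : a *: dg f = dg (fun k => a * f k).
Proof. by rewrite /dg -linearZ; congr diag_mx; apply/rowP => k; rewrite !mxE. Qed.
Let dgC a : a%:M = dg (fun=> a).
Proof. by rewrite /dg -diag_const_mx; congr diag_mx; apply/rowP => k; rewrite !mxE. Qed.
Let dg0 : 0 = dg (fun=> 0).
Proof. by rewrite -dgC; apply/matrixP => i j; rewrite !mxE mul0rn. Qed.
Let eq_dg f g : f =1 g -> dg f = dg g.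
Proof. by move=> fg; congr diag_mx; apply/rowP => k; rewrite !mxE. Qed.
Let dgJ f : (forall k, f k \is Num.real) -> (dg f) ^t* = dg f.
Proof.
move=> fR; rewrite tr_diag_mx map_diag_mx; congr diag_mx.
by apply/rowP => k; rewrite !mxE; apply/CrealP.
Qed.

Let a k := pair_cos (lam k) (mu k).
Let b k := pair_sin (lam k) (mu k).

Let aE k : a k * (lam k - mu k) = alpha + beta.
Proof. exact: pair_cosE. Qed.
Let abE k : b k ^+ 2 = 1 - a k ^+ 2.
Proof. by rewrite sqrtCK. Qed.

(** The direct sum of [r] plane reflections, the [k]-th acting on coordinates [k] and [r + k]. *)
Let J : 'M[C]_(r + r) := block_mx (dg a) (dg b) (dg b) (dg (fun k => - a k)).

Let J_symmetry : is_symmetry J.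
Proof.
have aR k : a k \is Num.real by exact: pair_cos_real.
have bR k : b k \is Num.real by exact: pair_sin_real.
apply/symmetryP; split.
  by rewrite tr_block_mx map_block_mx !dgJ // => k; rewrite rpredN.
rewrite mulmx_block !dgM !dgD scalar_mx_block dgC.
congr block_mx; rewrite ?dg0; apply: eq_dg => k; have := abE k; rewrite !expr2 => h.
all: by rewrite ?h; ring.
Qed.

Let e (i : 'I_(r + r)) := ev (split i).
Let sigma (i : 'I_(r + r)) := unsplit (tau (split i)).

Let D : diag_mx (\row_i e i) = block_mx (dg lam) 0 0 (dg mu).
Proof.
rewrite -diag_mx_row; congr diag_mx; apply/rowP => i; rewrite !mxE /e.
by case: split => k; rewrite mxE.
Qed.

Lemma Sym3_of_pairs : Sym 3 (two_scalar_mx r r alpha beta).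
Proof.
have mu1 k : `|mu k| = 1.
  have := congr1 Num.norm (lam_mu k).
  by rewrite normrN !normrM halpha hbeta lam1 !mul1r.
have sigmaK : involutive sigma by move=> i; rewrite /sigma unsplitK tauK splitK.
have e1 i : `|e i| = 1 by rewrite /e; case: split => k /=.
have eV i : e (sigma i) = (e i)^-1 by rewrite /e /sigma unsplitK.
have [J1 [J2 [s1 s2 DE]]] := diag_prod_symmetries sigmaK e1 eV.
pose A := J1 *m J2 *m J.
have AE : A = block_mx (dg (fun k => lam k * a k)) (dg (fun k => lam k * b k))
    (dg (fun k => mu k * b k)) (dg (fun k => mu k * - a k)).
  by rewrite /A -DE D mulmx_block !mul0mx !addr0 !add0r !dgM.
have SA : Sym 3 A by apply/Sym3P; exists J1, J2, J.
have sym_unitary S : is_symmetry S -> S \is unitarymx.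
  by move=> /symmetryP[SJ SS]; apply/unitarymxP; rewrite SJ.
have uA : A \is unitarymx by rewrite !mul_unitarymx // sym_unitary.
(* Cayley-Hamilton in each plane: the trace is [a k * (lam k - mu k) = alpha + beta], the
   determinant [- (lam k * mu k) = alpha * beta]. *)
have qA : A *m A = (alpha + beta) *: A - (alpha * beta)%:M.
  have ab k : alpha * beta = - (lam k * mu k) by rewrite lam_mu opprK.
  have sq k : lam k * mu k * (b k ^+ 2 - (1 - a k ^+ 2)) = 0.
    by rewrite abE subrr mulr0.
  rewrite AE mulmx_block !dgM !dgD scale_block_mx !dgZ scalar_mx_block dgC.
  rewrite opp_block_mx add_block_mx !subr0 !dgB.
  congr block_mx; apply: eq_dg => k; rewrite -?(aE k) ?(ab k); try by ring.
    by apply/eqP; rewrite -subr_eq0 -(sq k); apply/eqP; ring.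
  by apply/eqP; rewrite -subr_eq0 -(sq k); apply/eqP; ring.
have tA : \tr A = (alpha + beta) *+ r.
  rewrite AE mxtrace_block !mxtrace_diag -big_split /=.
  rewrite (eq_bigr (fun=> alpha + beta)) ?sumr_const ?card_ord // => k _.
  by rewrite !mxE -(aE k); ring.
have [W uW VE] := unitary_two_values hneq uA qA tA.
have -> : two_scalar_mx r r alpha beta = (W ^t*) ^t* *m A *m W ^t*.
  rewrite trmxCK VE !mulmxA (unitarymxP uW) mul1mx -mulmxA.
  by rewrite (unitarymxP uW) mulmx1.
by apply: (Sym3_conj _ SA); rewrite trmxC_unitary uW.
Qed.

End Sym3.
End Pairs.
End Construction.

(** * Explicit spectra realising the inequality *)

Section Sufficiency.
Variables (R : realType) (r : nat) (alpha beta : R[i]).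
Local Notation C := R[i].
Hypotheses (r2 : (2 <= r)%N) (halpha : `|alpha| = 1) (hbeta : `|beta| = 1).
Hypotheses (hneq : alpha <> beta) (hP : condition_P r r alpha beta).
Hypothesis hgap : antipode_gap r alpha beta.
Local Notation V := (two_scalar_mx r r alpha beta).

Let omega : C := - (alpha * beta).
Let omega1 : `|omega| = 1. Proof. by rewrite normrN normrM halpha hbeta mul1r. Qed.
Let omega0 : omega != 0. Proof. by rewrite -normr_gt0 omega1. Qed.

Let omega_pow_r : omega ^+ (2 * r) = 1.
Proof.
rewrite mulnC exprM /omega exprNn exprMn sqrr_sign mul1r.
by case: (prod_pow_r hP) => ->; rewrite ?sqrrN expr1n.
Qed.

Let neq1N1 : 1 <> -1 :> C.
Proof. by move=> /eqP; rewrite -subr_eq0 opprK -(natrD _ 1 1) pnatr_eq0. Qed.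

Let pred_modn n k : (0 < k < n)%N -> ((k + n).-1 %% n)%N = k.-1.
Proof.
by move=> /andP[k0 kn]; rewrite -(prednK k0) addSn /= modnDr modn_small //; lia.
Qed.

(* The spectrum of V J is the path 1, omega, omega^-1, omega^2, omega^-2, ...,
   omega^r, whose two ends are real. *)
Let Sym3_path : omega ^+ r = -1 -> Sym 3 V.
Proof.
move=> hr.
(* Partners multiply to [omega]. The inverse of [lam k] is [mu (k - 1)], except at the ends
   [lam 0 = 1] and [mu (r - 1) = -1], which [tau] fixes. *)
pose lam (k : 'I_r) := omega ^- k; pose mu (k : 'I_r) := omega ^+ k.+1.
pose tau (s : 'I_r + 'I_r) : 'I_r + 'I_r := match s with
  | inl k => if k == 0%N :> nat then inl k else inr (ord_pred k)
  | inr k => if k.+1 == r then inr k else inl (ordS k) end.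
apply: (@Sym3_of_pairs _ r alpha beta halpha hbeta hneq lam mu tau).
- by move=> k; rewrite normfV normrX omega1 expr1n invr1.
- by move=> k; rewrite /lam /mu exprSr mulKf // expf_neq0.
- move=> k.
  have -> : lam k + mu k = lam k * (1 - - omega ^+ (2 * k + 1)).
    rewrite opprK mulrDr mulr1; congr (_ + _); rewrite /lam /mu.
    by rewrite (_ : 2 * k + 1 = k + k.+1)%N ?exprD ?mulKf ?expf_neq0 //; lia.
  rewrite normrM normfV normrX omega1 expr1n invr1 mul1r.
  apply: antipode_gap_root hgap _ _ => //.
    by rewrite exprM sqrrN -!exprM mulnC exprM omega_pow_r expr1n.
  (* To refute [omega ^+ (2 * k + 1) = 1]: by (P) no exponent strictly between 0 and [r] gives 1 or
     -1. Dividing by [omega ^+ r = -1] leaves exponent [2 * k + 1 - r < r] with value -1, which is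
     impossible. *)
  move=> /oppr_inj h.
  have hk := ltn_ord k.
  have P m : omega ^+ m = 1 \/ omega ^+ m = -1 -> (0 < m)%N -> (r <= m)%N.
    move=> hm m0; suff : (2 * r <= m + m)%N by lia.
    apply: (condition_P_sqr hP); last by lia.
    have -> : alpha ^+ m * beta ^+ m = (-1) ^+ m * omega ^+ m.
      by rewrite -!exprMn mulN1r opprK.
    by rewrite exprMn sqrr_sign mul1r; case: hm => ->; rewrite ?sqrrN expr1n.
  have le1 : (r <= 2 * k + 1)%N by apply: P; [left|lia].
  have : omega ^+ (2 * k + 1 - r) = -1.
    apply: (mulfI (expf_neq0 r omega0)); rewrite -exprD subnKC // h hr.
    by rewrite mulrNN mulr1.
  have [e|ne] := eqVneq (2 * k + 1 - r)%N 0%N.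
    by rewrite e expr0 => /neq1N1.
  by move=> h'; have := P _ (or_intror h'); lia.
- case=> k /=.
    case: ifP => [k0|k0] /=; first by rewrite k0.
    have k1 : (0 < k < r)%N by rewrite lt0n k0 ltn_ord.
    by rewrite pred_modn // ifN ?ord_predK //; lia.
  case: ifP => [k0|k0] /=; first by rewrite k0.
  have k1 : (k.+1 < r)%N by rewrite ltn_neqAle k0 ltn_ord.
  by rewrite modn_small //= ordSK.
case=> k /=; case: ifP => [/eqP k0|k0]; rewrite /lam /mu /=.
- by rewrite k0 expr0 !invr1.
- have k1 : (0 < k < r)%N by rewrite lt0n k0 ltn_ord.
  by rewrite pred_modn // prednK ?invrK; case/andP: k1.
- by rewrite k0 hr invrN1.
by rewrite modn_small // ltn_neqAle k0 ltn_ord.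
Qed.

(* The spectrum of V J is a cycle of length 2 r through i and -i. *)
Let Sym3_cycle : odd r -> omega ^+ r = 1 -> Sym 3 V.
Proof.
move=> oddr hr; pose u : C := 'i%C.
have u2 : u * u = -1 by rewrite -expr2 sqr_i.
have u0 : u != 0 by apply/eqP => h; move/eqP: u2; rewrite h mul0r eq_sym oppr_eq0 oner_eq0.
have u1 : `|u| = 1.
  by apply/eqP; rewrite -(@pexpr_eq1 _ _ 2) // -normrX expr2 u2 normrN normr1.
have uV : u^-1 = - u by apply: (mulfI u0); rewrite mulfV // mulrN u2 opprK.
(* The factors [- u] and [u] are inverse to each other, so partners still multiply to [omega]; as
   [omega ^+ r = 1], inversion matches indices cyclically. *)
pose lam (k : 'I_r) := - u * omega ^- k; pose mu (k : 'I_r) := u * omega ^+ k.+1.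
pose tau (s : 'I_r + 'I_r) : 'I_r + 'I_r := match s with
  | inl k => inr (ord_pred k) | inr k => inl (ordS k) end.
have modr m : omega ^+ (m %% r) = omega ^+ m.
  by rewrite {2}(divn_eq m r) exprD mulnC exprM hr expr1n mul1r.
apply: (@Sym3_of_pairs _ r alpha beta halpha hbeta hneq lam mu tau).
- by move=> k; rewrite normrM normrN u1 normfV normrX omega1 expr1n invr1 mul1r.
- move=> k; rewrite /lam /mu exprSr mulrACA mulNr u2 opprK mul1r.
  by rewrite mulKf // expf_neq0.
- move=> k.
  have -> : lam k + mu k = lam k * (1 - omega ^+ (2 * k + 1)).
    rewrite (_ : 2 * k + 1 = k + k.+1)%N; last by lia.
    rewrite exprD /lam /mu; have := expf_neq0 k omega0.
    by move: (omega ^+ k) (omega ^+ k.+1) => x y x0; field.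
  rewrite normrM normrM normrN u1 normfV normrX omega1 expr1n invr1 !mul1r.
  apply: antipode_gap_root hgap _ _ => //.
    by rewrite -exprM mulnC exprM omega_pow_r expr1n.
  (* The [r]-th power of [omega ^+ (2 * k + 1) = -1] reads [1 = -1], because [r] is odd. *)
  move=> /(congr1 (fun x => x ^+ r)); rewrite -exprM mulnC exprM hr expr1n.
  by rewrite -signr_odd oddr expr1 => /neq1N1.
- by case=> k /=; rewrite ?ordSK ?ord_predK.
case=> k /=; rewrite /lam /mu invfM ?invrN ?invrK uV ?opprK.
  rewrite exprS modr -exprS; congr (_ * _).
  by rewrite (_ : (k + r).-1.+1 = k + r)%N ?exprD ?hr ?mulr1 //; lia.
by rewrite modr.
Qed.

Lemma antipode_gap_Sym3 : Sym 3 V.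
Proof.
have [ev|od] := boolP (~~ odd r).
  apply: Sym3_path; rewrite /omega exprNn -signr_odd (negbTE ev) mul1r.
  exact: prod_pow_even hP _.
rewrite negbK in od.
have ab : omega ^+ r = - (alpha * beta) ^+ r.
  by rewrite /omega exprNn -signr_odd od expr1 mulN1r.
case: (prod_pow_r hP) => h; rewrite h ?opprK in ab.
  exact: Sym3_cycle.
exact: Sym3_path.
Qed.

End Sufficiency.

Theorem theorem3p24 (R : realType) (d r s : nat) (alpha beta : R[i])
  (hd4 : (4 <= d)%N) (hdeven : ~~ odd d) (hdrs : d = (r + s)%N) (hrs : r = s)
  (halpha : `|alpha| = 1) (hbeta : `|beta| = 1) (hneq : alpha <> beta)
  (hP : condition_P r s alpha beta) :
  Sym 3 (two_scalar_mx r s alpha beta) <->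
  [\/ [/\ (4 %| d)%N,
          (alpha * beta) ^+ r = -1
        & `|expi ((r%:R - 1) / r%:R * pi) - 1| < `|alpha - beta| ],
      ~~ (4 %| d)%N /\
          `|expi ((r%:R - 1) / r%:R * pi) - 1| < `|alpha - beta|
    | [/\ ~~ (4 %| d)%N,
          (alpha * beta) ^+ r = -1
        & forall j : nat, (1 <= j <= r - 1)%N ->
            `|1 - alpha ^+ (2 * j + 1) * beta ^+ (2 * j - 1)|
              < `|alpha - beta| ] ].
Proof.
subst s; have r2 : (2 <= r)%N by lia.
have b0 : beta != 0 by rewrite -normr_gt0 hbeta.
have d4 : (4 %| d)%N = ~~ odd r by lia.
split=> [/(Sym3_antipode_gap r2 halpha hbeta hneq hP) gap|h].
  (* The parity of [r] selects (ii) or (i). *)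
  rewrite d4; have [od|ev] := boolP (odd r); first by apply: Or32.
  by apply: Or31; split=> //; exact: prod_pow_even hP ev.
apply: antipode_gap_Sym3 => //; case: h => [[]|[]|[_ _ h]] //.
apply: (antipode_gap_of_coset r2 halpha hbeta hneq hP (norm_ratio halpha hbeta)) => k kr.
(* The element [k = 0] of the coset of [alpha / beta] is outside the range of (iii); there the bound
   is an equality. *)
have [->|k0] := posnP k; first by rewrite expr0 mulr1 -norm_sub_ratio.
have -> : alpha / beta * (alpha * beta) ^+ (2 * k) =
    alpha ^+ (2 * k + 1) * beta ^+ (2 * k - 1).
  rewrite exprMn addn1 exprS mulrACA; congr (_ * _).
  by rewrite (_ : 2 * k = (2 * k - 1).+1)%N ?exprS ?mulKf ?subn1 //; lia.
by apply/ltW/h; lia.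
Qed.
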